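(* Let $a(n)$ denote the total area of all $(-1)$-Dyck paths of semi-length $n$. The generating function for the sequence $a(n)$ is given by $$V(x)=\sum_{n\geq 0} a(n)x^n=\frac{b(x) - c(x)\sqrt{1-4x+2x^2+x^4}}{(1- x)^2 (1 - 4 x + 2 x^2)^3 (1 - 3 x - x^2 - x^3)},$$ where $$b(x)=2 x - 23 x^2 + 107 x^3 - 262 x^4 + 359 x^5 - 256 x^6 + 82 x^7 - 5 x^8 - 10 x^9 + 6 x^{10},$$ $$c(x)=x - 10 x^2 + 41 x^3 - 89 x^4 + 108 x^5 - 73 x^6 + 18 x^7 + 2 x^8.$$
   Context: A Dyck path is a lattice path in the first quadrant that starts at the origin, ends on the $x$-axis, and consists of steps $U=(1,1)$ and $D=(1,-1)$ (never going below the $x$-axis). Its semi-length is its number of $U$ steps. A valley is an occurrence of two consecutive steps $DU$; the level of a valley is the $y$-coordinate of its lowest point. Let $\nu=(\nu_1,\dots,\nu_k)$ be the levels of all valleys of $P$, listed from left to right. A Dyck path is called $(-1)$-Dyck if it has at most one valley or if $\nu_{i+1}-\nu_i\ge -1$ for all $1\le i<k$. The area of a Dyck path is the sum of the $y$-coordinates of all lattice points visited by the path (equivalently, the area of the region between the path and the $x$-axis). In particular $a(0)=0$. The identity is one of formal power series, the square root being the one with constant term $1$. *)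

(* Defs.v *)
From HB Require Import structures.
From mathcomp Require Import all_boot all_order all_algebra.
From mathcomp Require Import boolp.

Set Implicit Arguments.
Unset Strict Implicit.
Unset Printing Implicit Defensive.

Import Order.TTheory GRing.Theory Num.Theory.
Local Open Scope ring_scope.

(** * Formal power series in one variable *)

(* A dedicated record: [nat -> R] itself may carry pointwise operations. *)
Record fps (R : Type) := Fps { fcoef : nat -> R }.

Lemma fpsP (R : Type) (f g : fps R) : fcoef f =1 fcoef g <-> f = g.
Proof.
split=> [|-> //]; case: f g => [f] [g] /= fg; congr Fps.
exact: funext.
Qed.

HB.instance Definition _ (R : Type) := gen_eqMixin (fps R).
HB.instance Definition _ (R : Type) := gen_choiceMixin (fps R).

Section FpsZmod.
Variable R : zmodType.
Implicit Types f g h : fps R.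

Definition fps_zero : fps R := Fps (fun=> 0).
Definition fps_opp f := Fps (fun n => - fcoef f n).
Definition fps_add f g := Fps (fun n => fcoef f n + fcoef g n).

Fact fps_addA : associative fps_add.
Proof. by move=> f g h; apply/fpsP => n /=; rewrite addrA. Qed.
Fact fps_addC : commutative fps_add.
Proof. by move=> f g; apply/fpsP => n /=; rewrite addrC. Qed.
Fact fps_add0 : left_id fps_zero fps_add.
Proof. by move=> f; apply/fpsP => n /=; rewrite add0r. Qed.
Fact fps_addN : left_inverse fps_zero fps_opp fps_add.
Proof. by move=> f; apply/fpsP => n /=; rewrite addNr. Qed.

HB.instance Definition _ :=
  GRing.isZmodule.Build (fps R) fps_addA fps_addC fps_add0 fps_addN.

Lemma fcoef0 n : fcoef (0 : fps R) n = 0. Proof. by []. Qed.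
Lemma fcoefD f g n : fcoef (f + g) n = fcoef f n + fcoef g n.
Proof. by []. Qed.
Lemma fcoefN f n : fcoef (- f) n = - fcoef f n. Proof. by []. Qed.
Lemma fcoefB f g n : fcoef (f - g) n = fcoef f n - fcoef g n.
Proof. by []. Qed.

End FpsZmod.

Section FpsComRing.
Variable R : comNzRingType.
Implicit Types f g h : fps R.

Definition fps_one : fps R := Fps (fun n => (n == 0%N)%:R).
Definition fps_mul f g :=
  Fps (fun n => \sum_(i < n.+1) fcoef f i * fcoef g (n - i)%N).

Let trunc n f : {poly R} := \poly_(i < n.+1) fcoef f i.

Let trunc_coef n f i : (i <= n)%N -> (trunc n f)`_i = fcoef f i.
Proof. by rewrite coef_poly ltnS => ->. Qed.

Let mul_trunc f g n i : (i <= n)%N ->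
  fcoef (fps_mul f g) i = (trunc n f * trunc n g)`_i.
Proof.
move=> le_in; rewrite coefM /=; apply: eq_bigr => j _.
rewrite !trunc_coef //; first by rewrite (leq_trans (leq_subr _ _)).
by rewrite (leq_trans _ le_in) // -ltnS.
Qed.

Let eq_coefM (p p' q q' : {poly R}) n :
  (forall i, (i <= n)%N -> p`_i = p'`_i) ->
  (forall i, (i <= n)%N -> q`_i = q'`_i) -> (p * q)`_n = (p' * q')`_n.
Proof.
move=> Hp Hq; rewrite !coefM; apply: eq_bigr => j _.
by rewrite Hp ?Hq ?leq_subr // -ltnS.
Qed.

Fact fps_mulC : commutative fps_mul.
Proof. by move=> f g; apply/fpsP => n; rewrite !(mul_trunc _ _ (leqnn n)) mulrC. Qed.

Fact fps_mulA : associative fps_mul.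
Proof.
move=> f g h; apply/fpsP => n; rewrite !(mul_trunc _ _ (leqnn n)).
transitivity ((trunc n f * (trunc n g * trunc n h))`_n).
  by apply: eq_coefM => // i le_in; rewrite trunc_coef // (mul_trunc _ _ le_in).
rewrite mulrA; apply: eq_coefM => // i le_in.
by rewrite trunc_coef // (mul_trunc _ _ le_in).
Qed.

Fact fps_mul1 : left_id fps_one fps_mul.
Proof.
move=> f; apply/fpsP => n /=; rewrite big_ord_recl /= mul1r subn0 big1 ?addr0 //.
by move=> i _; rewrite mul0r.
Qed.

Fact fps_mulDl : left_distributive fps_mul +%R.
Proof.
move=> f g h; apply/fpsP => n /=; rewrite -big_split /=.
by apply: eq_bigr => i _; rewrite mulrDl.
Qed.

Fact fps_one_neq0 : fps_one != 0.
Proof. by apply/eqP => /fpsP/(_ 0%N) /= /eqP; rewrite oner_eq0. Qed.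

HB.instance Definition _ := GRing.Zmodule_isComNzRing.Build (fps R)
  fps_mulA fps_mulC fps_mul1 fps_mulDl fps_one_neq0.

Lemma fcoef1 n : fcoef (1 : fps R) n = (n == 0%N)%:R. Proof. by []. Qed.
Lemma fcoefM f g n :
  fcoef (f * g) n = \sum_(i < n.+1) fcoef f i * fcoef g (n - i)%N.
Proof. by []. Qed.
Lemma fcoefM0 f g : fcoef (f * g) 0 = fcoef f 0 * fcoef g 0.
Proof. by rewrite fcoefM big_ord1. Qed.

Definition fpsX : fps R := Fps (fun n => (n == 1%N)%:R).

(* The series s with s_n = step [:: s_0; ...; s_(n-1)] for every n. *)
Fixpoint fps_prefix (step : seq R -> R) (n : nat) : seq R :=
  if n is m.+1 then
    let s := fps_prefix step m in rcons s (step s)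
  else [::].
Definition fps_rec step : fps R := Fps (fun n => step (fps_prefix step n)).

Lemma fps_recE step n : fcoef (fps_rec step) n = step (fps_prefix step n).
Proof. by []. Qed.

Lemma size_fps_prefix step n : size (fps_prefix step n) = n.
Proof. by elim: n => //= n IHn; rewrite size_rcons IHn. Qed.

Lemma nth_fps_prefix step n i : (i < n)%N ->
  (fps_prefix step n)`_i = fcoef (fps_rec step) i.
Proof.
elim: n => //= n IHn; rewrite ltnS nth_rcons size_fps_prefix leq_eqVlt.
by case/predU1P=> [-> | lt_in]; [rewrite ltnn eqxx | rewrite lt_in IHn].
Qed.

End FpsComRing.

Section FpsField.
Variable R : fieldType.
Implicit Types f g h : fps R.

Definition fps_inv_step f (s : seq R) : R :=
  let n := size s in
  if n == 0%N then (fcoef f 0)^-1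
  else - (fcoef f 0)^-1 * \sum_(i < n) s`_i * fcoef f (n - i)%N.

(* The second branch follows the convention that a non-unit is its own
   inverse. *)
Definition fps_inv f : fps R :=
  if fcoef f 0 != 0 then fps_rec (fps_inv_step f) else f.

Definition fps_unit : pred (fps R) := fun f => fcoef f 0 != 0.

Fact fps_mulVf : {in fps_unit, left_inverse 1 fps_inv *%R}.
Proof.
move=> f f0; have {}f0 : fcoef f 0 != 0 := f0; rewrite /fps_inv f0.
set g := fps_rec _.
have gS n : fcoef g n.+1 =
    - (fcoef f 0)^-1 * \sum_(i < n.+1) fcoef g i * fcoef f (n.+1 - i)%N.
  rewrite {1}/g fps_recE /fps_inv_step size_fps_prefix; congr (_ * _).
  by apply: eq_bigr => i _; rewrite nth_fps_prefix.
apply/fpsP => -[|n]; first by rewrite fcoefM0 fps_recE /= mulVf.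
rewrite fcoefM big_ord_recr subnn gS mulrAC mulNr mulVf // mulN1r.
by rewrite fcoef1 [LHS]subrr.
Qed.

Fact fps_unitP f g : g * f = 1 -> fps_unit f.
Proof.
move=> /fpsP/(_ 0%N); rewrite fcoefM0 /= /fps_unit => gf.
by apply/eqP => f0; move/eqP: gf; rewrite f0 mulr0 eq_sym oner_eq0.
Qed.

Fact fps_inv_out : {in [predC fps_unit], fps_inv =1 id}.
Proof. by move=> f f0; have {}f0 : ~~ (fcoef f 0 != 0) := f0; rewrite /fps_inv (negbTE f0). Qed.

HB.instance Definition _ := GRing.ComNzRing_hasMulInverse.Build (fps R)
  fps_mulVf fps_unitP fps_inv_out.

Lemma fps_unitE f : (f \is a GRing.unit) = (fcoef f 0 != 0).
Proof. by []. Qed.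

(* Solves s_0 = 1 and sum_(i <= n) s_i s_(n-i) = f_n for n > 0; meaningful
   when f_0 = 1 and 2 != 0 in R, see [fps_sqrtK] and [fps_sqrt_unique]. *)
Definition fps_sqrt_step f (s : seq R) : R :=
  let n := size s in
  if n == 0%N then 1
  else (fcoef f n - \sum_(1 <= i < n) s`_i * s`_(n - i)) / 2.
Definition fps_sqrt f : fps R := fps_rec (fps_sqrt_step f).

Lemma fps_sqrt0 f : fcoef (fps_sqrt f) 0 = 1. Proof. by []. Qed.

Lemma fcoef_sqr g n :
  fcoef (g ^+ 2) n.+1 = fcoef g 0 * fcoef g n.+1 *+ 2
    + \sum_(1 <= i < n.+1) fcoef g i * fcoef g (n.+1 - i)%N.
Proof.
rewrite expr2 fcoefM -(big_mkord xpredT (fun i => fcoef g i * fcoef g (n.+1 - i)%N)).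
rewrite big_nat_recr //= big_ltn // subnn subn0 addrAC mulr2n.
by rewrite [fcoef g n.+1 * _]mulrC.
Qed.

Lemma fps_sqrtK f : (2 : R) != 0 -> fcoef f 0 = 1 -> fps_sqrt f ^+ 2 = f.
Proof.
move=> nz2 f0; apply/fpsP => -[|n].
  by rewrite expr2 fcoefM0 fps_sqrt0 mul1r f0.
have sS : fcoef (fps_sqrt f) n.+1 = (fcoef f n.+1
    - \sum_(1 <= i < n.+1) fcoef (fps_sqrt f) i
        * fcoef (fps_sqrt f) (n.+1 - i)%N) / 2.
  rewrite {1}/fps_sqrt fps_recE /fps_sqrt_step size_fps_prefix.
  congr ((_ - _) / _); apply: eq_big_nat => i /andP[i_gt0 lt_in].
  by rewrite !nth_fps_prefix // ltn_subrL i_gt0.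
by rewrite fcoef_sqr fps_sqrt0 mul1r sS -[_ *+ 2]mulr_natr divfK // subrK.
Qed.

Lemma fps_sqrt_unique f g : (2 : R) != 0 ->
  fcoef g 0 = 1 -> g ^+ 2 = f -> g = fps_sqrt f.
Proof.
move=> nz2 g0 gf.
have f0 : fcoef f 0 = 1 by rewrite -gf expr2 fcoefM0 g0 mulr1.
have U : g + fps_sqrt f \is a GRing.unit.
  by rewrite fps_unitE fcoefD g0 fps_sqrt0.
apply/eqP; rewrite -subr_eq0; apply/eqP; apply: (mulIr U).
by rewrite mul0r -subr_sqr fps_sqrtK // gf subrr.
Qed.

End FpsField.

(** * Lattice paths, Dyck paths and (-1)-Dyck paths *)

(* A path from the origin is its list of steps, with U = (1,1) = true and
   D = (1,-1) = false. *)
Local Notation U := true (only parsing).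
Local Notation D := false (only parsing).

Definition ycoord (P : seq bool) (i : nat) : int :=
  (count_mem U (take i P))%:Z - (count_mem D (take i P))%:Z.

Definition dyck (P : seq bool) : bool :=
  all (fun i => 0 <= ycoord P i) (iota 0 (size P).+1)
  && (ycoord P (size P) == 0).

Definition semilength (P : seq bool) : nat := count_mem U P.

(* Steps are numbered from 0, so the bottom of the valley formed by steps i
   and i+1 is the point with abscissa i+1. The default values exclude
   positions outside the path. *)
Definition valleys (P : seq bool) : seq nat :=
  [seq i <- iota 0 (size P) | (nth U P i == D) && (nth D P i.+1 == U)].

Definition valley_levels (P : seq bool) : seq int :=
  [seq ycoord P i.+1 | i <- valleys P].

Definition m1dyck (P : seq bool) : bool :=
  let nu := valley_levels P in
  dyck P && ((size nu <= 1)%N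
             || all (fun i => -1 <= nu`_i.+1 - nu`_i) (iota 0 (size nu).-1)).

Definition area (P : seq bool) : int := \sum_(i < (size P).+1) ycoord P i.

Lemma size_dyck P : dyck P -> size P = (semilength P).*2.
Proof.
case/andP=> _; rewrite /ycoord take_size subr_eq0 eqz_nat => /eqP eqUD.
rewrite -(count_predC (pred1 U) P) -addnn /semilength; congr (_ + _)%N.
by rewrite eqUD; apply: eq_count => -[].
Qed.

(* By [size_dyck], all Dyck paths of semi-length n are lists of 2n steps. *)
Definition total_area (n : nat) : int :=
  \sum_(P : n.*2.-tuple bool | m1dyck P && (semilength P == n)) area P.

Definition area_gf : fps rat := Fps (fun n => (total_area n)%:~R).

(* Main.v *)
Require Import Defs.
From mathcomp Require Import all_boot all_order all_algebra.
From mathcomp Require Import ring zify.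
Import Order.TTheory GRing.Theory Num.Theory.
Local Open Scope ring_scope.

(** A nonempty Dyck path factors uniquely as [U l D r] with [l] and [r] Dyck
    paths (first return to the axis). Its valley levels are those of [l]
    raised by 1, then, when [r] is nonempty, a valley at level 0 followed by
    those of [r]. Hence, for nonempty [r], the path is (-1)-Dyck exactly when
    [l] and [r] are and the last valley of [l], if any, has level 0; call such
    an [l] low. In turn [U l D r] is low exactly when [l] and [r] are low, or
    when [r] is empty and [l] has no valley (a pyramid). The three generating
    functions by semi-length, P (pyramids), E (low paths) and D (all
    (-1)-Dyck paths), therefore satisfy
      P = 1 + x P,  E = 1 + x (E (E - 1) + P),  D = 1 + x (E (D - 1) + D).

    Raising [l] by one unit adds 2 |l| + 1 to its area, |l| being its
    semi-length, so the area of [U l D r] is area l + 2 |l| + 1 + area r. The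
    area generating functions thus satisfy linear equations with coefficients
    in x, P, E, D and their images under theta = x d/dx, and applying theta to
    the equations above determines those images ([gf_first_return],
    [area_gf_first_return]).

    Finally E is a root of a quadratic whose discriminant gives
    sqrt(1 - 4x + 2x^2 + x^4) = (1 - x)(1 + x - 2xE), and solving the linear
    equations in the ring generated by x, 1/(1-x) and this square root yields
    the closed form ([closed_form]). *)

(** * Heights and the first-return decomposition *)

(* the change of height along a step, and the height at the end of a path *)
Local Notation rise b := (if b then 1 else - 1 : int).
Local Notation final P := (ycoord P (size P)).

Local Arguments ycoord : simpl never.

Lemma ycoord_nil i : ycoord [::] i = 0.
Proof. by []. Qed.

Lemma ycoord0 P : ycoord P 0 = 0.
Proof. by rewrite /ycoord take0. Qed.

Lemma ycoord_cons b P i : ycoord (b :: P) i.+1 = rise b + ycoord P i.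
Proof. by rewrite /ycoord; case: b => /=; lia. Qed.

Lemma final_cons b P : final (b :: P) = rise b + final P.
Proof. exact: ycoord_cons. Qed.

(** [dyck_from h P]: the path [P], started at height [h], stays at
    nonnegative height and ends at height 0. *)
Fixpoint dyck_from (h : nat) (P : seq bool) : bool :=
  match P with
  | [::] => h == 0
  | true :: Q => dyck_from h.+1 Q
  | false :: Q => if h is k.+1 then dyck_from k Q else false
  end.

Lemma dyck_fromE h P :
  all (fun i => 0 <= h%:Z + ycoord P i) (iota 0 (size P).+1)
    && (h%:Z + final P == 0) = dyck_from h P.
Proof.
elim: P h => [|b P IH] h; first by rewrite /= ycoord_nil; lia.
have -> : iota 0 (size (b :: P)).+1 = 0%N :: map S (iota 0 (size P).+1).
  by rewrite /= -!(iotaDl 1).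
rewrite final_cons -[0%N :: _]cat1s all_cat all_seq1 all_map ycoord0 addr0.
rewrite [0 <= _]/= andTb.
case: b; last case: h => [|h]; rewrite [dyck_from _ _]/=.
- rewrite -IH; congr (_ && _); last by lia.
  by apply: eq_all => i /=; rewrite ycoord_cons; lia.
- by rewrite /= ycoord_cons ycoord0.
- rewrite -IH; congr (_ && _); last by lia.
  by apply: eq_all => i /=; rewrite ycoord_cons; lia.
Qed.

Lemma dyckE P : dyck P = dyck_from 0 P.
Proof.
rewrite -dyck_fromE /dyck add0r; congr (_ && _).
by apply: eq_all => i; rewrite add0r.
Qed.

Lemma dyck_final P : dyck P -> final P = 0.
Proof. by case/andP=> _ /eqP. Qed.

(** The path [U l D r]. *)
Definition node (l r : seq bool) : seq bool := true :: l ++ false :: r.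

(** Running a path that descends from [j] to 0, but [h] units higher, leads
    from height [j + h] to height [h]. *)
Lemma dyck_from_cat j h l q :
  dyck_from j l -> dyck_from (j + h) (l ++ q) = dyck_from h q.
Proof.
elim: l j => [|[] l IH] [|j] //=; first exact: IH; first exact: IH.
exact: IH.
Qed.

Lemma dyck_node l r : dyck l -> dyck (node l r) = dyck r.
Proof. by rewrite !dyckE /= => /(dyck_from_cat _ 1 _ (false :: r)) ->. Qed.

(** Cutting at the first step that goes below the initial height. *)
Lemma dyck_from_split h P : dyck_from h.+1 P ->
  exists l r, [/\ P = l ++ false :: r, dyck l & dyck_from h r].
Proof.
have [n] := ubnP (size P); elim: n P h => // n IH [|[] P] h //=.
  rewrite ltnS => ltP hP.
  have [l [r [eP hl hr]]] := IH P h.+1 ltP hP.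
  have ltr : (size r < n)%N.
    by move: ltP; rewrite eP size_cat /=; lia.
  (* after a U step two descents have to be split off *)
  have [l' [r' [er hl' hr']]] := IH r h ltr hr.
  exists (node l l'), r'; split=> //; last by rewrite dyck_node.
  by rewrite eP er /node /= -catA.
by move=> _ hP; exists [::], P.
Qed.

Lemma dyck_nodeP P : dyck P -> P <> [::] ->
  exists l r, [/\ P = node l r, dyck l & dyck r].
Proof.
rewrite dyckE; case: P => [|[] P] //= hP _.
have [l [r [-> hl hr]]] := dyck_from_split _ _ hP.
by exists l, r; rewrite (dyckE r).
Qed.

(** Descending from height [j], the displayed D step is the first one to go
    below 0, so that its position is determined by the whole path. *)
Lemma dyck_from_first_return j l l' r r' :
  dyck_from j l -> dyck_from j l' ->
  l ++ false :: r = l' ++ false :: r' -> l = l' /\ r = r'.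
Proof.
elim: l l' j => [|b l IH] [|b' l'] j //=; first by move=> _ _ [].
- by move=> /eqP -> h [e _]; rewrite -e in h.
- by move=> h /eqP j0 [e _]; rewrite e j0 in h.
move=> h h' [eb /(IH l')]; rewrite -eb in h' *.
case: b h h' {eb} => [|]; last case: j => // j.
  by move=> h h' /(_ _ h h') [-> ->].
by move=> h h' /(_ _ h h') [-> ->].
Qed.

Lemma node_inj l l' r r' : dyck l -> dyck l' ->
  node l r = node l' r' -> l = l' /\ r = r'.
Proof.
by rewrite !dyckE => hl hl' []; apply: dyck_from_first_return hl hl'.
Qed.

(** * Area *)

Lemma area_cons b P : area (b :: P) = rise b * (size P).+1%:Z + area P.
Proof.
rewrite /area big_ord_recl ycoord0 add0r.
under eq_bigr => i _ do rewrite ycoord_cons.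
by rewrite big_split sumr_const card_ord /= -mulr_natr natz.
Qed.

Lemma area_cat l q :
  area (l ++ q) = area l + final l * (size q)%:Z + area q.
Proof.
elim: l => [|b l IH]; first by rewrite /area big_ord1 /= !ycoord_nil; lia.
by rewrite cat_cons !area_cons IH final_cons size_cat; lia.
Qed.

Lemma area_node l r : dyck l ->
  area (node l r) = area l + (semilength l).*2.+1%:Z + area r.
Proof.
move=> hl; rewrite /node area_cons area_cat area_cons dyck_final //.
by rewrite size_cat /= -size_dyck //; lia.
Qed.

Lemma semilength_node l r :
  semilength (node l r) = (semilength l + semilength r).+1.
Proof. by rewrite /semilength /= count_cat /= !add0n add1n. Qed.

(** * Valleys *)

Lemma valleys_cons b P : valleys (b :: P) =
  [seq i <- [:: 0%N] | ~~ b && head false P] ++ map S (valleys P).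
Proof.
rewrite /valleys.
have -> : iota 0 (size (b :: P)) = 0%N :: map S (iota 0 (size P)).
  by rewrite /= -(iotaDl 1).
rewrite -[0%N :: _]cat1s filter_cat filter_map; congr (_ ++ _).
by rewrite /= nth0; case: b; case: (head _ _).
Qed.

Lemma levels_cons b P : valley_levels (b :: P) =
  [seq i <- [:: rise b] | ~~ b && head false P]
    ++ [seq rise b + v | v <- valley_levels P].
Proof.
rewrite /valley_levels valleys_cons map_cat; congr (_ ++ _).
  case: b; case: (head false P) => //=.
  by rewrite ycoord_cons ycoord0.
by rewrite -!map_comp; apply: eq_map => i /=; rewrite ycoord_cons.
Qed.

(** A D step creates no valley with what precedes it, whence the choice of
    the second factor. *)
Lemma levels_cat l r : valley_levels (l ++ false :: r) =
  valley_levels l ++ [seq final l + v | v <- valley_levels (false :: r)].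
Proof.
elim: l => [|b l IH].
  by rewrite /= ycoord_nil; under eq_map => v do rewrite add0r; rewrite map_id.
rewrite cat_cons !(levels_cons b) IH map_cat catA final_cons.
congr ((_ ++ _) ++ _); first by case: l {IH}.
by rewrite -map_comp; apply: eq_map => v /=; rewrite addrA.
Qed.

Lemma levels_node l r : dyck l -> dyck r -> valley_levels (node l r) =
  [seq 1 + v | v <- valley_levels l]
    ++ (if r is [::] then [::] else 0 :: valley_levels r).
Proof.
move=> hl hr; rewrite levels_cons levels_cat dyck_final //.
rewrite [filter _ _]/= cat0s map_cat; congr (_ ++ _).
rewrite levels_cons -map_comp map_cat.
(* a valley at the middle D step bottoms out at level 1 - 1 = 0, and [r] starts
   at that level *)
have -> : [seq (fun v => 1 + v) ((fun v => 0 + v) i)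
            | i <- [seq -1 + v | v <- valley_levels r]] = valley_levels r.
  rewrite -map_comp -[RHS]map_id; apply: eq_map => v /=; lia.
by case: r hr => // -[] // r; rewrite dyckE.
Qed.

Lemma levels_ge0 P : dyck P -> all (fun v => 0 <= v) (valley_levels P).
Proof.
case/andP=> /allP h _; apply/allP => _ /mapP[i + ->].
rewrite mem_filter mem_iota => /andP[_ hi]; apply: h.
by rewrite mem_iota; lia.
Qed.

(** The condition on consecutive valley levels of a (-1)-Dyck path. *)
Definition slow_descent : rel int := fun a b => -1 <= b - a.

Lemma m1dyckE P : m1dyck P = dyck P && sorted slow_descent (valley_levels P).
Proof.
rewrite /m1dyck; congr (_ && _); set nu := valley_levels P.
apply/orP/(sortedP 0) => [[small i|/allP h i] lti | h].
- by move: (leq_trans lti small).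
- by apply: h; rewrite mem_iota add0n ltn_predRL.
by right; apply/allP => i; rewrite mem_iota add0n ltn_predRL => /h.
Qed.

(** Dyck paths without valleys, the paths [U^k D^k]; the empty path counts. *)
Definition pyramid P := dyck P && (valley_levels P == [::]).

(** Low (-1)-Dyck paths: the last valley, if there is one, has level 0; the
    default value 0 of [last] admits the paths without valleys. These are the
    paths that remain (-1)-Dyck when raised by one unit and followed by a
    valley at level 0. *)
Definition m1low P := m1dyck P && (last 0 (valley_levels P) <= 0).

Lemma m1dyck_node l r : dyck l -> dyck r -> m1dyck (node l r) =
  if r == [::] then m1dyck l else m1low l && m1dyck r.
Proof.
move=> hl hr; rewrite /m1low !m1dyckE dyck_node // hl hr /= levels_node //.
have /= sorted_shift s :
    sorted slow_descent [seq 1 + v | v <- s] = sorted slow_descent s.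
  rewrite sorted_map; apply: eq_sorted => a b /=; rewrite /slow_descent; lia.
case: r hr => [|b r] hr; first by rewrite cats0 sorted_shift.
(* no constraint between the valley at level 0 and the next one *)
have hr' : path slow_descent 0 (valley_levels (b :: r))
    = sorted slow_descent (valley_levels (b :: r)).
  apply: path_min_sorted; apply: sub_all (levels_ge0 _ hr) => v.
  by rewrite /slow_descent; lia.
move: (valley_levels l) (sorted_shift (valley_levels l)) => [|v s] /=.
  by rewrite hr'.
rewrite cat_path last_map /= hr' /slow_descent => ->.
by rewrite -andbA; congr [&& _, _ & _]; lia.
Qed.

Lemma m1low_node l r : dyck l -> dyck r -> m1low (node l r) =
  if r == [::] then pyramid l else m1low l && m1low r.
Proof.
move=> hl hr; rewrite {1 3}/m1low m1dyck_node // levels_node //.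
case: eqVneq => [->|]; last first.
  by case: r hr => [|b r] //= _; rewrite last_cat /= andbA.
(* the valleys of the raised path have level at least 1, so it is low only if
   it has none *)
rewrite cats0 /pyramid hl.
have := levels_ge0 _ hl.
case/lastP eqs: (valley_levels l) => [|s v] //=.
  by rewrite m1dyckE hl eqs.
rewrite map_rcons last_rcons all_rcons => /andP[hv _].
have -> : (1 + v <= 0) = false by lia.
by rewrite andbF; case: s {eqs}.
Qed.

Lemma pyramid_node l r : dyck l -> dyck r -> pyramid (node l r) =
  if r == [::] then pyramid l else false.
Proof.
move=> hl hr; rewrite /pyramid dyck_node // hl hr levels_node //=.
by case: r hr => [|b r] _; case: (valley_levels l).
Qed.

(** * Generating functions *)

(** The Dyck paths of semi-length [n], without repetition. *)
Definition dyck_words (n : nat) : seq (seq bool) :=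
  [seq P <- map val (enum {: n.*2.-tuple bool})
     | dyck P && (semilength P == n)].

Lemma mem_dyck_words n P :
  (P \in dyck_words n) = dyck P && (semilength P == n).
Proof.
rewrite mem_filter; apply: andb_idr => /andP[hP /eqP hn].
have sP : size P == n.*2 by rewrite size_dyck // hn.
by apply/mapP; exists (Tuple sP); rewrite // mem_enum.
Qed.

Lemma dyck_words_uniq n : uniq (dyck_words n).
Proof. by rewrite filter_uniq // map_inj_uniq ?enum_uniq //; apply: val_inj. Qed.

Lemma dyck_words0 : dyck_words 0 = [:: [::]].
Proof.
apply: perm_small_eq => //; apply: uniq_perm => //; first exact: dyck_words_uniq.
move=> P; rewrite mem_dyck_words inE; apply/andP/eqP => [[hP /eqP h]|-> //].
by apply/nilP; rewrite /nilp size_dyck // h.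
Qed.

(** The first-return decomposition as a bijection. *)
Lemma dyck_wordsS n : perm_eq (dyck_words n.+1)
  [seq node l r | l <- [seq P | i <- iota 0 n.+1, P <- dyck_words i],
                  r <- dyck_words (n - semilength l)].
Proof.
have memL P : (P \in [seq P | i <- iota 0 n.+1, P <- dyck_words i])
    = dyck P && (semilength P <= n)%N.
  apply/allpairsPdep/andP => [[i [Q [hi hQ ->]]]|[hP hn]].
    move: hQ; rewrite mem_dyck_words => /andP[-> /eqP ->].
    by rewrite mem_iota in hi.
  by exists (semilength P), P; rewrite mem_iota mem_dyck_words hP eqxx.
apply: uniq_perm; first exact: dyck_words_uniq.
  apply: allpairs_uniq_dep.
  - apply: allpairs_uniq_dep => [|i _|]; first exact: iota_uniq.
      exact: dyck_words_uniq.
    move=> _ _ /allpairsPdep[i [P [_ hP ->]]] /allpairsPdep[j [Q [_ hQ ->]]] /= e.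
    move: hP hQ; rewrite !mem_dyck_words -e => /andP[_ /eqP <-] /andP[_ /eqP <-].
    by [].
  - by move=> l _; apply: dyck_words_uniq.
  move=> _ _ /allpairsPdep[l [r [hl _ ->]]] /allpairsPdep[l' [r' [hl' _ ->]]] /=.
  move: hl hl'; rewrite !memL => /andP[hl _] /andP[hl' _].
  by move/(node_inj _ _ _ _ hl hl') => [-> ->].
move=> P; rewrite mem_dyck_words.
apply/andP/allpairsPdep => [[hP /eqP hn]|[l [r [+ + ->]]]].
  have [|l [r [eP hl hr]]] := dyck_nodeP _ hP; first by move=> e; rewrite e in hn.
  move: hn; rewrite eP semilength_node => -[hn].
  exists l, r; rewrite memL mem_dyck_words hl hr -hn leq_addr; split=> //.
  by rewrite addKn eqxx.
rewrite memL mem_dyck_words => /andP[hl hn] /andP[hr /eqP er].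
by rewrite dyck_node // semilength_node er subnKC.
Qed.

(** Generating function, by semi-length, of the Dyck paths weighted by [w]. *)
Definition gf (w : seq bool -> rat) : fps rat :=
  Fps (fun n => \sum_(P <- dyck_words n) w P).

(** Generating function, by total semi-length, of the pairs of Dyck paths
    weighted by [w]. *)
Definition gf2 (w : seq bool -> seq bool -> rat) : fps rat :=
  Fps (fun n => \sum_(i < n.+1) \sum_(l <- dyck_words i)
                  \sum_(r <- dyck_words (n - i)) w l r).

Lemma eq_gf2 w w' :
  (forall l r, dyck l -> dyck r -> w l r = w' l r) -> gf2 w = gf2 w'.
Proof.
move=> eww'; apply/fpsP => n; apply: eq_bigr => i _.
apply: eq_big_seq => l; rewrite mem_dyck_words => /andP[hl _].
by apply: eq_big_seq => r; rewrite mem_dyck_words => /andP[hr _]; apply: eww'.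
Qed.

Lemma eq_gf w w' : (forall P, dyck P -> w P = w' P) -> gf w = gf w'.
Proof.
move=> eww'; apply/fpsP => n.
by apply: eq_big_seq => l; rewrite mem_dyck_words => /andP[hl _]; apply: eww'.
Qed.

Lemma gfD w w' : gf (fun P => w P + w' P) = gf w + gf w'.
Proof. by apply/fpsP => n; rewrite fcoefD /= big_split. Qed.

Lemma gf2D w w' : gf2 (fun l r => w l r + w' l r) = gf2 w + gf2 w'.
Proof.
apply/fpsP => n; rewrite fcoefD /= -big_split; apply: eq_bigr => i _.
by rewrite -big_split; apply: eq_bigr => l _; rewrite big_split.
Qed.

Lemma gf2M w w' : gf2 (fun l r => w l * w' r) = gf w * gf w'.
Proof.
apply/fpsP => n; rewrite fcoefM; apply: eq_bigr => i _.
by rewrite big_distrl; apply: eq_bigr => l _; rewrite big_distrr.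
Qed.

Lemma fcoefXM (f : fps rat) n :
  fcoef (fpsX rat * f) n = if n is k.+1 then fcoef f k else 0.
Proof.
rewrite fcoefM big_ord_recl /= mul0r add0r.
case: n => [|n]; first by rewrite big_ord0.
rewrite big_ord_recl /= mul1r subn1 big1 ?addr0 // => i _.
by rewrite mul0r.
Qed.

(** A boolean [c] covers the two values 0 and 1 that the weight of the empty
    path takes below. *)
Lemma gf_node (c : bool) w : w [::] = c%:R ->
  gf w = c%:R + fpsX rat * gf2 (fun l r => w (node l r)).
Proof.
move=> w0; have c0 n : fcoef (c%:R : fps rat) n = (c && (n == 0%N))%:R.
  by case: (c); rewrite ?fcoef1 ?fcoef0.
apply/fpsP => n; rewrite fcoefD fcoefXM c0.
case: n => [|n] /=; first by rewrite dyck_words0 big_seq1 w0 andbT addr0.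
rewrite andbF add0r (perm_big _ (dyck_wordsS n)) big_allpairs_dep.
rewrite big_allpairs_dep -[iota 0 n.+1]/(index_iota 0 n.+1) big_mkord.
apply: eq_bigr => i _; apply: eq_big_seq => l.
by rewrite mem_dyck_words => /andP[_ /eqP ->].
Qed.

(** The derivation x d/dx. *)
Definition theta (f : fps rat) : fps rat := Fps (fun n => n%:R * fcoef f n).

Lemma thetaD f g : theta (f + g) = theta f + theta g.
Proof. by apply/fpsP => n; rewrite fcoefD /= mulrDr. Qed.

Lemma thetaM f g : theta (f * g) = theta f * g + f * theta g.
Proof.
apply/fpsP => n; rewrite fcoefD !fcoefM /= big_distrr -big_split.
apply: eq_bigr => i _ /=.
rewrite -{1}(subnKC (ltn_ord i : (i <= n)%N)) natrD; ring.
Qed.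

Lemma theta1 : theta 1 = 0.
Proof. by apply/fpsP => -[|n]; rewrite fcoef0 /= ?mulr0 ?mul0r. Qed.

Lemma thetaX : theta (fpsX rat) = fpsX rat.
Proof. by apply/fpsP => -[|[|n]]; rewrite /= ?mulr0 ?mul0r ?mulr1. Qed.

Lemma thetaB1 f : theta (f - 1) = theta f.
Proof. by have := thetaD (f - 1) 1; rewrite subrK theta1 addr0. Qed.

Lemma gf_semilength w :
  gf (fun P => (semilength P)%:R * w P) = theta (gf w).
Proof.
apply/fpsP => n; rewrite /= big_distrr; apply: eq_big_seq => P.
by rewrite mem_dyck_words => /andP[_ /eqP ->].
Qed.

(** * Functional equations *)

Lemma gf0 : gf (fun=> 0) = 0.
Proof. by apply/fpsP => n; rewrite /= big1. Qed.

Lemma gf_empty : gf (fun P => (P == [::])%:R) = 1.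
Proof.
rewrite (gf_node true) //= -[RHS]addr0; congr (_ + _).
have -> : gf2 (fun _ _ => 0) = gf2 (fun _ _ => 0 * 0).
  by apply: eq_gf2 => *; rewrite mulr0.
by rewrite (gf2M (fun=> 0) (fun=> 0)) gf0 !mulr0.
Qed.

(** Generating function of the areas of Dyck paths weighted by [w]. *)
Definition area_gf_of (w : seq bool -> rat) : fps rat :=
  gf (fun P => w P * (area P)%:~R).

(** The same for the area of the path [U P D] in place of that of [P], still
    counted by the semi-length of [P]; see [lifted_area_gfE]. *)
Definition lifted_area_gf_of w : fps rat :=
  area_gf_of w + 2 * theta (gf w) + gf w.

Lemma lifted_area_gfE w : lifted_area_gf_of w =
  gf (fun P => w P * ((area P)%:~R + (semilength P).*2.+1%:R)).
Proof.
rewrite /lifted_area_gf_of -gf_semilength mulr2n mulrDl mul1r -!gfD.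
by apply: eq_gf => P _; rewrite -addn1 natrD -addnn natrD; ring.
Qed.

(** A weight [w] that is multiplicative along the first-return decomposition,
    with a special rule [v] when the right factor is empty, yields functional
    equations for both of its generating functions. *)
Section FirstReturn.
Variables w u v : seq bool -> rat.
Hypothesis w_nil : w [::] = 1.
Hypothesis w_node : forall l r, dyck l -> dyck r ->
  w (node l r) = if r == [::] then v l else u l * w r.

(* [w] with the empty path discarded *)
Let w_nonempty P := w P - (P == [::])%:R.

Let gf_nonempty : gf w_nonempty = gf w - 1.
Proof.
rewrite -gf_empty; apply: (addIr (gf (fun P => (P == [::])%:R))).
by rewrite subrK -gfD; apply: eq_gf => P _; rewrite subrK.
Qed.

Lemma gf_first_return : gf w = 1 + fpsX rat * (gf u * (gf w - 1) + gf v).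
Proof.
rewrite {1}(gf_node true) //; congr (_ + _ * _).
rewrite -gf_nonempty -[gf v]mulr1 -gf_empty -!gf2M -gf2D.
apply: eq_gf2 => l r hl hr; rewrite w_node // /w_nonempty.
by case: eqP => [->|_] /=; rewrite ?w_nil; ring.
Qed.

Lemma area_gf_first_return : area_gf_of w =
  fpsX rat * (lifted_area_gf_of u * (gf w - 1) + gf u * area_gf_of w
              + lifted_area_gf_of v).
Proof.
have area0 : area [::] = 0 by rewrite /area big_ord1.
rewrite {1}/area_gf_of (gf_node false) ?area0 ?mulr0 // add0r; congr (_ * _).
rewrite -gf_nonempty -[lifted_area_gf_of v]mulr1 -gf_empty !lifted_area_gfE.
rewrite -!gf2M -!gf2D; apply: eq_gf2 => l r hl hr.
rewrite w_node // area_node // /w_nonempty !rmorphD /= -!pmulrn.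
by case: eqP => [->|_] /=; rewrite ?w_nil ?area0; ring.
Qed.

End FirstReturn.

Lemma gf_pyramid (P := fun Q => (pyramid Q)%:R) :
  gf P = 1 + fpsX rat * gf P
  /\ area_gf_of P = fpsX rat * lifted_area_gf_of P.
Proof.
have h l r : dyck l -> dyck r ->
    P (node l r) = if r == [::] then P l else 0 * P r.
  by move=> hl hr; rewrite /P pyramid_node //; case: ifP => // _; rewrite mul0r.
have P0 : P [::] = 1 by [].
have L0 : lifted_area_gf_of (fun=> 0) = 0.
  rewrite lifted_area_gfE -gf0; apply: eq_gf => *; exact: mul0r.
rewrite {1}(gf_first_return _ _ _ P0 h) {1}(area_gf_first_return _ _ _ P0 h).
by rewrite gf0 L0 !mul0r !add0r.
Qed.

Lemma gf_m1low (P := fun Q => (pyramid Q)%:R) (E := fun Q => (m1low Q)%:R) :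
  gf E = 1 + fpsX rat * (gf E * (gf E - 1) + gf P)
  /\ area_gf_of E =
    fpsX rat * (lifted_area_gf_of E * (gf E - 1) + gf E * area_gf_of E
                + lifted_area_gf_of P).
Proof.
have h l r : dyck l -> dyck r ->
    E (node l r) = if r == [::] then P l else E l * E r.
  move=> hl hr; rewrite /E m1low_node //; case: ifP => // _.
  by rewrite -natrM mulnb.
by split; [apply: gf_first_return | apply: area_gf_first_return].
Qed.

Lemma gf_m1dyck (E := fun Q => (m1low Q)%:R) (D := fun Q => (m1dyck Q)%:R) :
  gf D = 1 + fpsX rat * (gf E * (gf D - 1) + gf D)
  /\ area_gf_of D =
    fpsX rat * (lifted_area_gf_of E * (gf D - 1) + gf E * area_gf_of D
                + lifted_area_gf_of D).
Proof.
have h l r : dyck l -> dyck r ->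
    D (node l r) = if r == [::] then D l else E l * D r.
  move=> hl hr; rewrite /D m1dyck_node //; case: ifP => // _.
  by rewrite -natrM mulnb.
by split; [apply: gf_first_return | apply: area_gf_first_return].
Qed.

Lemma area_gfE : area_gf = area_gf_of (fun P => (m1dyck P)%:R).
Proof.
apply/fpsP => n; rewrite /= /total_area rmorph_sum /=.
rewrite big_filter big_map big_enum_cond /=.
rewrite [LHS]big_mkcond [RHS]big_mkcond; apply: eq_bigr => P _.
case: (boolP (m1dyck P)) => /=; last by rewrite mul0r; case: ifP.
by rewrite {1}/m1dyck mul1r => /andP[-> _].
Qed.

(** * Solving the equations *)

(** Here [tP], [tE], [tD] play the part of theta applied to [P], [E], [D], and
    [PA], [EA], [DA] that of the area generating functions. Apart from that of
    [E] the equations are linear in their left-hand sides, with leading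
    coefficient 1 - x for [P], [tP], [PA], then s / (1 - x) for [tE], [EA], and
    1 - x - x E for [D], [tD], [DA]; all are units. As P = 1 / (1 - x), the
    multiples x E, x E + x tE (that is, theta (x E)) and x EA are, up to unit
    factors, polynomials in x, P and s, and the rules x P = P - 1 and
    s^2 = disc bring such polynomials to normal form. *)
Section ClosedForm.
Variables (R : comUnitRingType) (x P tP PA E tE EA D tD DA s : R).
Hypothesis unit2 : (2 : R) \is a GRing.unit.
Hypothesis unit_s : s \is a GRing.unit.
Hypothesis unit_1Bx : 1 - x \is a GRing.unit.
Hypothesis unit_lead : 1 - x - x * E \is a GRing.unit.
Hypothesis hP : P = 1 + x * P.
Hypothesis htP : tP = x * (P + tP).
Hypothesis hPA : PA = x * (PA + 2 * tP + P).
Hypothesis hE : E = 1 + x * (E * (E - 1) + P).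
Hypothesis htE :
  tE = x * (E * (E - 1) + P + (tE * (E - 1) + E * tE + tP)).
Hypothesis hEA :
  EA = x * ((EA + 2 * tE + E) * (E - 1) + E * EA + (PA + 2 * tP + P)).
Hypothesis hD : D = 1 + x * (E * (D - 1) + D).
Hypothesis htD :
  tD = x * (E * (D - 1) + D + (tE * (D - 1) + E * tD + tD)).
Hypothesis hDA :
  DA = x * ((EA + 2 * tE + E) * (D - 1) + E * DA + (DA + 2 * tD + D)).
Hypothesis hs : s = (1 - x) * (1 + x - 2 * (x * E)).

(* the radicand *)
Let disc : R := 1 - 4 * x + 2 * x ^+ 2 + x ^+ 4.

Lemma xP_eq : x * P = P - 1.
Proof. by rewrite [in RHS]hP; ring. Qed.

Lemma xE2_eq : x * E ^+ 2 = (1 + x) * E - P.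
Proof.
have -> : x * E ^+ 2 = 1 + x * (E * (E - 1) + P) - 1 - x * P + x * E by ring.
by rewrite -hE; ring: xP_eq.
Qed.

Lemma s_sqr : s ^+ 2 = disc.
Proof.
by rewrite hs /disc; ring: xE2_eq xP_eq.
Qed.

Lemma tP_eq : tP = x * P ^+ 2.
Proof.
apply: (mulrI unit_1Bx).
have -> : (1 - x) * tP = x * P by rewrite mulrBl mul1r {1}htP; ring.
by ring: xP_eq.
Qed.

Lemma PA_eq : PA = x * (1 + x) * P ^+ 3.
Proof.
apply: (mulrI unit_1Bx).
have -> : (1 - x) * PA = x * (2 * tP + P) by rewrite mulrBl mul1r {1}hPA; ring.
by rewrite tP_eq; ring: xP_eq.
Qed.

Lemma xE_eq : 2 * (x * E) = 1 + x - P * s.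
Proof. by rewrite hs; ring: xP_eq. Qed.

Lemma theta_xE_eq : 2 * disc * (x * E + x * tE)
  = s * (1 - x) * (x - x ^+ 2 + x * P * s + 2 * (x * tP + x * P - x)).
Proof.
(* theta applied to the quadratic equation of x E *)
have h : (1 + x - 2 * (x * E)) * (x * E + x * tE)
   = x - x * (x * E) + (x * tP + x * P - x).
  have -> : (1 + x - 2 * (x * E)) * (x * E + x * tE) =
    x * (tE - x * (tE * (E - 1) + E * tE)) + x * E * (1 + x) - 2 * x * (x * E ^+ 2).
    by ring.
  rewrite {1}htE.
  have -> : x * (x * (E * (E - 1) + P + (tE * (E - 1) + E * tE + tP)) -
     x * (tE * (E - 1) + E * tE)) = x * (x * E ^+ 2 - x * E + x * P + x * tP) by ring.
  by rewrite xE2_eq xP_eq tP_eq; ring: xP_eq.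
rewrite -s_sqr.
transitivity (2 * s * (1 - x) * ((1 + x - 2 * (x * E)) * (x * E + x * tE))).
  set TF := _ + x * tE.
  have -> : 2 * s * (1 - x) * ((1 + x - 2 * (x * E)) * TF) =
    2 * s * ((1 - x) * (1 + x - 2 * (x * E))) * TF by ring.
  by rewrite -hs; ring.
rewrite h.
have -> : x - x ^+ 2 + x * P * s = 2 * x - x * (1 + x - P * s) by ring.
by rewrite -xE_eq; ring.
Qed.

Lemma xEA_eq : 4 * disc ^+ 2 * P * (x * EA) =
  s * ((2 * (2 * disc * (x * E + x * tE)) - disc * (2 * (x * E)))
    * (2 * (x * E) - 2 * x) + 4 * disc * x * PA).
Proof.
have h : P * s * (x * EA) =
   (2 * (x * E + x * tE) - x * E) * (x * E - x) + x * PA.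
  have -> : P * s = 1 + x - 2 * (x * E) by rewrite xE_eq; ring.
  have -> : (1 + x - 2 * (x * E)) * (x * EA)
    = x * (EA - x * (EA * (E - 1) + E * EA)) by ring.
  have -> : x * PA = x * (x * (PA + 2 * tP + P)) by rewrite -hPA.
  by rewrite {1}hEA; ring.
transitivity (4 * disc * s * (P * s * (x * EA))).
  have -> : 4 * disc * s * (P * s * (x * EA)) = 4 * disc * s ^+ 2 * P * (x * EA).
    by ring.
  by rewrite s_sqr; ring.
by rewrite h; ring.
Qed.

(* the leading coefficient of the linear equations for [D], [tD], [DA] *)
Let lead := 1 - x - x * E.

(** [D - 1], [tD] and [DA] have the denominators [lead], [lead ^+ 2] and
    [lead ^+ 3]. *)
Lemma DA_eq : DA * lead ^+ 3 =
  x * (lead * (x * EA + 2 * (x * E + x * tE) - x * E)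
  + 2 * (lead * x + (x + (x * E + x * tE)) * x) + lead * x + lead ^+ 2).
Proof.
have hD1 : (D - 1) * lead = x.
  have -> : (D - 1) * lead = D - 1 - x * (E * (D - 1) + D - 1) by rewrite /lead; ring.
  by rewrite {1}hD; ring.
have htD1 : tD * lead = x + (x + (x * E + x * tE)) * (D - 1).
  have -> : tD * lead = tD - x * (E * tD + tD) by rewrite /lead; ring.
  by rewrite {1}htD; ring.
have htD2 : tD * lead ^+ 2 = x * lead + (x + (x * E + x * tE)) * x.
  have -> : tD * lead ^+ 2 = tD * lead * lead by ring.
  by rewrite htD1 -[in X in _ = _ + _ * X]hD1; ring.
have h : DA * lead = x * ((EA + 2 * tE + E) * (D - 1) + (2 * tD + (D - 1) + 1)).
  have -> : DA * lead = DA - x * (E * DA + DA) by rewrite /lead; ring.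
  by rewrite {1}hDA; ring.
have -> : DA * lead ^+ 3 = DA * lead * lead ^+ 2 by ring.
rewrite h.
have -> : x * ((EA + 2 * tE + E) * (D - 1) + (2 * tD + (D - 1) + 1)) * lead ^+ 2 =
   x * ((EA + 2 * tE + E) * ((D - 1) * lead) * lead
        + 2 * (tD * lead ^+ 2) + ((D - 1) * lead) * lead + lead ^+ 2) by ring.
by rewrite htD2 hD1; ring.
Qed.

(** The theorem with the denominator cleared. After multiplication by the unit
    16 disc^2 P lead^3, both sides become polynomials in x, P and s. *)
Lemma closed_form : let b : R :=
    2 * x - 23 * x ^+ 2 + 107 * x ^+ 3 - 262 * x ^+ 4 + 359 * x ^+ 5
    - 256 * x ^+ 6 + 82 * x ^+ 7 - 5 * x ^+ 8 - 10 * x ^+ 9 + 6 * x ^+ 10 in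
  let c : R :=
    x - 10 * x ^+ 2 + 41 * x ^+ 3 - 89 * x ^+ 4 + 108 * x ^+ 5
    - 73 * x ^+ 6 + 18 * x ^+ 7 + 2 * x ^+ 8 in
  DA * ((1 - x) ^+ 2 * (1 - 4 * x + 2 * x ^+ 2) ^+ 3
       * (1 - 3 * x - x ^+ 2 - x ^+ 3)) = b - c * s.
Proof.
move=> b c.
set den := _ * (1 - _ - _ - _).
have unit_disc : disc \is a GRing.unit by rewrite -s_sqr unitrX.
have unitP : P \is a GRing.unit.
  by apply/unitrP; exists (1 - x); split; ring: xP_eq.
have u : lead ^+ 3 * 2 ^+ 4 * disc ^+ 2 * P \is a GRing.unit.
  by rewrite unitrMr // unitrMr ?unitrX // unitrMr ?unitrX.
apply: (mulIr u).
(* [g], [T] and [A] are, up to factors, [lead], theta (x E) and x EA written as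
   polynomials in x, P and s, with tP and PA still to be expanded *)
pose g := 1 - 3 * x + P * s.
have hg : 2 * lead = g.
  by rewrite -[LHS]/(2 * (1 - x - x * E)) mulrBr xE_eq /g; ring.
pose T := s * (1 - x) * (x - x ^+ 2 + x * P * s + 2 * (x * tP + x * P - x)).
have hT : 2 * disc * (x * E + x * tE) = T by exact: theta_xE_eq.
pose A := s * ((2 * T - disc * (1 + x - P * s))
    * (1 + x - P * s - 2 * x) + 4 * disc * x * PA).
have hA : 4 * disc ^+ 2 * P * (x * EA) = A by rewrite xEA_eq hT xE_eq.
transitivity (den * x * (2 * g * A + 8 * disc * P * g * T
   - 4 * disc ^+ 2 * P * g * (1 + x - P * s)
  + 16 * disc ^+ 2 * P * g * x + 32 * disc ^+ 2 * P * x ^+ 2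
  + 16 * disc * P * x * T + 8 * disc ^+ 2 * P * x * g + 4 * disc ^+ 2 * P * g ^+ 2)).
  have -> : DA * den * (lead ^+ 3 * 2 ^+ 4 * disc ^+ 2 * P) =
     den * (2 ^+ 4 * disc ^+ 2 * P) * (DA * lead ^+ 3) by ring.
  by rewrite DA_eq -hA -hT -hg -xE_eq; ring.
have -> : (b - c * s) * (lead ^+ 3 * 2 ^+ 4 * disc ^+ 2 * P) =
  (b - c * s) * (g ^+ 3 * 2 * disc ^+ 2 * P) by rewrite -hg; ring.
have h1 := s_sqr; have h2 := xP_eq.
rewrite /A /T /g PA_eq tP_eq /den /b /c.
rewrite /disc in h1 *.
by ring: h1 h2.
Qed.
End ClosedForm.

(** * The generating function of the areas *)

Lemma coef0_1DX (f : fps rat) : fcoef (1 + fpsX rat * f) 0 = 1.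
Proof. by rewrite fcoefD fcoefM0 mul0r addr0. Qed.

Lemma unit_1DX (f : fps rat) : 1 + fpsX rat * f \is a GRing.unit.
Proof. by rewrite fps_unitE coef0_1DX. Qed.

Theorem theorem4p1 :
  let x : fps rat := fpsX rat in
  let b : fps rat :=
    2 * x - 23 * x ^+ 2 + 107 * x ^+ 3 - 262 * x ^+ 4 + 359 * x ^+ 5
    - 256 * x ^+ 6 + 82 * x ^+ 7 - 5 * x ^+ 8 - 10 * x ^+ 9 + 6 * x ^+ 10 in
  let c : fps rat :=
    x - 10 * x ^+ 2 + 41 * x ^+ 3 - 89 * x ^+ 4 + 108 * x ^+ 5
    - 73 * x ^+ 6 + 18 * x ^+ 7 + 2 * x ^+ 8 in
  area_gf =
    (b - c * fps_sqrt (1 - 4 * x + 2 * x ^+ 2 + x ^+ 4))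
    / ((1 - x) ^+ 2 * (1 - 4 * x + 2 * x ^+ 2) ^+ 3
       * (1 - 3 * x - x ^+ 2 - x ^+ 3)).
Proof.
move=> x b c.
have [hP hPA] := gf_pyramid; have [hE hEA] := gf_m1low.
have [hD hDA] := gf_m1dyck.
rewrite area_gfE; move: hPA hEA hDA; rewrite /lifted_area_gf_of.
set DA := area_gf_of (fun P => (m1dyck P)%:R).
set EA := area_gf_of (fun P => (m1low P)%:R).
set PA := area_gf_of (fun P => (pyramid P)%:R).
move: hP hE hD.
set D := gf (fun P => (m1dyck P)%:R).
set E := gf (fun P => (m1low P)%:R).
set P := gf (fun P => (pyramid P)%:R).
rewrite -/x => hP hE hD hPA hEA hDA.
have htP : theta P = x * (P + theta P).
  by rewrite {1}hP thetaD theta1 add0r thetaM thetaX mulrDr.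
have htE : theta E =
    x * (E * (E - 1) + P + (theta E * (E - 1) + E * theta E + theta P)).
  rewrite {1}hE thetaD theta1 add0r thetaM thetaX -mulrDr; congr (_ * (_ + _)).
  by rewrite thetaD thetaM thetaB1.
have htD : theta D =
    x * (E * (D - 1) + D + (theta E * (D - 1) + E * theta D + theta D)).
  rewrite {1}hD thetaD theta1 add0r thetaM thetaX -mulrDr; congr (_ * (_ + _)).
  by rewrite thetaD thetaM thetaB1.
pose s := (1 - x) * (1 + x - 2 * (x * E)).
have s1DX : s = 1 + x * (- x - 2 * E + 2 * x * E) by rewrite /s; ring.
have -> : fps_sqrt (1 - 4 * x + 2 * x ^+ 2 + x ^+ 4) = s.
  (* [s] squares to the radicand because [E] is a root of
     x E^2 - (1 + x) E + P *)
  apply/esym/fps_sqrt_unique => //; first by rewrite s1DX coef0_1DX.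
  exact: s_sqr hP hE (erefl s).
have unit_den : (1 - x) ^+ 2 * (1 - 4 * x + 2 * x ^+ 2) ^+ 3
    * (1 - 3 * x - x ^+ 2 - x ^+ 3) \is a GRing.unit.
  have u1 : 1 - x \is a GRing.unit by rewrite -mulrN1 unit_1DX.
  have u2 : 1 - 4 * x + 2 * x ^+ 2 \is a GRing.unit.
    have -> : 1 - 4 * x + 2 * x ^+ 2 = 1 + x * (2 * x - 4) by ring.
    exact: unit_1DX.
  have u3 : 1 - 3 * x - x ^+ 2 - x ^+ 3 \is a GRing.unit.
    have -> : 1 - 3 * x - x ^+ 2 - x ^+ 3 = 1 + x * (- 3 - x - x ^+ 2) by ring.
    exact: unit_1DX.
  by rewrite unitrMr // unitrMr unitrX.
apply: (mulIr unit_den); rewrite divrK //.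
apply: (closed_form _ x P (theta P) PA E (theta E) EA D (theta D) DA) => //.
- by rewrite s1DX unit_1DX.
- have -> : 1 - x - x * E = 1 + x * (- 1 - E) by ring.
  exact: unit_1DX.
Qed.
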